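(* Let $d\ge 1$ and let $k\in[1,d]$ be a real number that is not an integer. Then the facets of the polytope $k\rho_{d,k}$ are exactly the polytopes of the form $\mathrm{conv}(\gamma_{d-\lfloor k\rfloor-1}\cup\alpha)$, where $\gamma_{d-\lfloor k\rfloor-1}$ is a $(d-\lfloor k\rfloor-1)$-dimensional face of the hypercube $\gamma_d$ and $\alpha$ is a $(\lfloor k\rfloor-1)$-dimensional simplex whose vertices are any $\lfloor k\rfloor$ of the $\lfloor k\rfloor+1$ points $k\,c_F$, with $F$ ranging over the $\lfloor k\rfloor+1$ facets of $\gamma_d$ that contain $\gamma_{d-\lfloor k\rfloor-1}$.
   Context: $\gamma_d=[-1,1]^d\subset\mathbb{R}^d$ is the hypercube, and $\beta_d$ is the cross-polytope whose vertices are the centers $\pm e_1,\dots,\pm e_d$ of the facets of $\gamma_d$ (where $e_1,\dots,e_d$ is the standard basis). For $k\in[1,d]$, $\rho_{d,k}=\mathrm{conv}\left(\beta_d\cup\frac{1}{k}\gamma_d\right)$, so that $k\rho_{d,k}=\mathrm{conv}(k\beta_d\cup\gamma_d)$. For a facet $F$ of $\gamma_d$, $c_F$ denotes its center (one of the points $\pm e_j$); the point $k\,c_F$ is called the point pulled from the center of $F$. *)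

(* Defs.v *)
From HB Require Import structures.
From mathcomp Require Import all_boot all_order all_algebra.
From mathcomp Require Import boolp classical_sets cardinality reals convex.

Set Implicit Arguments.
Unset Strict Implicit.
Unset Printing Implicit Defensive.

Import Order.TTheory GRing.Theory Num.Theory.
Local Open Scope classical_set_scope.
Local Open Scope ring_scope.

Section Polytopes.
Variables (R : realType) (d : nat).
Implicit Types (A P F S : set 'rV[R]_d) (a x c : 'rV[R]_d) (n : nat).

Definition convex_hull A : set 'rV[R]_d := smallest (@convex_set R _) A.

Definition affine_hull A : set 'rV[R]_d :=
  [set x | exists n (w : 'I_n -> R) (p : 'I_n -> 'rV[R]_d),
     [/\ \sum_(i < n) w i = 1,
         forall i, A (p i) &
         x = \sum_(i < n) w i *: p i]].

(* The empty set has no dimension in this sense. *)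
Definition has_dim A n : Prop :=
  exists x (V : {vspace 'rV[R]_d}),
    \dim V = n /\ affine_hull A = [set x + v | v in [set v | v \in V]].

(* The improper faces P (a = 0, b = 0) and the empty set (a = 0, b = 1) are
   included. *)
Definition is_face P F : Prop :=
  exists a (b : R),
    (forall x, P x -> \sum_(i < d) a 0 i * x 0 i <= b) /\
    F = P `&` [set x | \sum_(i < d) a 0 i * x 0 i = b].

Definition is_facet P F : Prop :=
  is_face P F /\ exists n, has_dim P n.+1 /\ has_dim F n.

Definition affine_independent n (p : 'I_n -> 'rV[R]_d) : Prop :=
  forall w : 'I_n -> R,
    \sum_(i < n) w i = 0 -> \sum_(i < n) w i *: p i = 0 -> forall i, w i = 0.

Definition is_simplex n S A : Prop :=
  exists p : 'I_n.+1 -> 'rV[R]_d,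
    [/\ affine_independent p, S = range p & A = convex_hull S].

(* Center of symmetry; it is unique when A is bounded and nonempty. *)
Definition is_center A c : Prop := forall x, A x -> A (2 *: c - x).

Definition scale (t : R) A : set 'rV[R]_d := [set t *: x | x in A].

End Polytopes.

Definition hypercube (R : realType) (d : nat) : set 'rV[R]_d :=
  [set x | forall i, -1 <= x 0 i <= 1].
Arguments hypercube R d _ : clear implicits.

Definition cross_polytope (R : realType) (d : nat) : set 'rV[R]_d :=
  convex_hull [set x | exists j, x = delta_mx 0 j \/ x = - delta_mx 0 j].
Arguments cross_polytope R d _ : clear implicits.

Definition rho (R : realType) (d : nat) (k : R) : set 'rV[R]_d :=
  convex_hull (cross_polytope R d `|` scale k^-1 (hypercube R d)).
Arguments rho {R} d k _.

Definition facets_containing (R : realType) (d : nat) (P G : set 'rV[R]_d) :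
    set (set 'rV[R]_d) :=
  [set F | is_facet P F /\ G `<=` F].

Definition pulled_points (R : realType) (d : nat) (k : R) (G : set 'rV[R]_d) :
    set 'rV[R]_d :=
  [set y | exists F c,
     [/\ facets_containing (hypercube R d) G F, is_center F c & y = k *: c]].
Arguments pulled_points {R d} k G _.

(* Main.v *)
Require Import Defs.
From mathcomp Require Import all_boot all_order all_algebra.
From mathcomp Require Import boolp classical_sets cardinality reals convex.
From mathcomp Require Import interval_inference ring lra.

Local Open Scope classical_set_scope.
Local Open Scope card_scope.
Local Open Scope ring_scope.

Set Implicit Arguments.
Unset Strict Implicit.
Unset Printing Implicit Defensive.

Import Order.TTheory GRing.Theory Num.Theory.

(* [k rho] is the hull of the points [+- k e_j] and of the cube, so a . x <= b holds on it iff
   k |a_j| <= b for all j and sum_j |a_j| <= b.  A facet spans a hyperplane missing the origin,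
   hence determines its normal a once b is scaled to k.  If sum_j |a_j| < k, a coordinate with
   |a_j| < 1 could be changed freely; if two of the |a_j| were strictly between 0 and 1, weight
   could be moved from one to the other.  So sum_j |a_j| = k with at most one fractional |a_j|,
   and since k is not an integer there is exactly one, at some j0: m = floor k of the |a_j| are 1
   and |a_{j0}| = k - m.  The cube vertices on such a hyperplane are those of the cube face fixed
   by the signs of a, and the points k e_j, up to sign, on it are those with |a_j| = 1, which are
   all the pulled points of that face but the one of index j0. *)

(** * Convex and affine hulls *)

Section Hulls.
Variables (R : realType) (d : nat).
Implicit Types (A B C : set 'rV[R]_d) (a x y z : 'rV[R]_d) (b t : R).

Definition dot a x : R := \sum_(i < d) a 0 i * x 0 i.

Lemma dotDr a x y : dot a (x + y) = dot a x + dot a y.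
Proof. by rewrite -big_split/=; apply: eq_bigr => i _; rewrite mxE mulrDr. Qed.

Lemma dotZr a t x : dot a (t *: x) = t * dot a x.
Proof. by rewrite mulr_sumr; apply: eq_bigr => i _; rewrite mxE mulrCA. Qed.

Lemma dotC a x : dot a x = dot x a.
Proof. by apply: eq_bigr => i _; rewrite mulrC. Qed.

Lemma dotNr a x : dot a (- x) = - dot a x.
Proof. by rewrite -scaleN1r dotZr mulN1r. Qed.

Lemma dot_deltar a j : dot a (delta_mx 0 j) = a 0 j.
Proof.
rewrite /dot (bigD1 j)//= big1 => [|i ij]; first by rewrite mxE !eqxx mulr1 addr0.
by rewrite mxE (negPf ij) andbF mulr0.
Qed.

Lemma convex_setP A :
  convex_set A <->
  forall x y t, 0 <= t <= 1 -> A x -> A y -> A (t *: x + (1 - t) *: y).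
Proof.
split=> [cA x y t t01 Ax Ay|cA x y l /set_mem Ax /set_mem Ay].
  case/andP: (t01) => t0 t1.
  have /set_mem := cA x y (Itv01 t0 t1) (mem_set Ax) (mem_set Ay).
  by [].
apply/mem_set; apply: cA => //.
by rewrite ge0 le1.
Qed.

Lemma convex_convex_hull A : convex_set (convex_hull A).
Proof.
apply/convex_setP => x y t t01 hx hy C [cC AC].
by move/convex_setP: (cC); apply=> //; [apply: hx|apply: hy].
Qed.

Lemma sub_convex_hull A : A `<=` convex_hull A.
Proof. exact: sub_gen_smallest. Qed.

Lemma convex_hull_min A C : convex_set C -> A `<=` C -> convex_hull A `<=` C.
Proof. exact: smallest_sub. Qed.

Lemma convex_hullS A B : A `<=` B -> convex_hull A `<=` convex_hull B.
Proof.
move=> AB; apply: convex_hull_min; first exact: convex_convex_hull.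
by apply: subset_trans AB _; exact: sub_convex_hull.
Qed.

Lemma convex_hullUl A B : convex_hull (convex_hull A `|` B) = convex_hull (A `|` B).
Proof.
apply/seteqP; split; last by apply: convex_hullS; apply: setSU; exact: sub_convex_hull.
apply: convex_hull_min; first exact: convex_convex_hull.
rewrite subUset; split; first by apply: convex_hullS => x; left.
by move=> x Bx; apply: sub_convex_hull; right.
Qed.

Lemma convex_hullUr A B : convex_hull (A `|` convex_hull B) = convex_hull (A `|` B).
Proof. by rewrite setUC convex_hullUl setUC. Qed.

Lemma convex_halfspace a b : convex_set [set x | dot a x <= b].
Proof.
apply/convex_setP => x y t /andP[t0 t1] /= hx hy.
rewrite dotDr !dotZr; nra.
Qed.

Lemma scale_convex_hull t A : scale t (convex_hull A) = convex_hull (scale t A).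
Proof.
apply/seteqP; split.
  move=> _ [x hx <-]; move: x hx.
  apply: (@convex_hull_min _ [set x | convex_hull (scale t A) (t *: x)]).
    apply/convex_setP => x y u u01 /= hx hy.
    rewrite scalerDr !scalerA ![t * _]mulrC -!scalerA.
    by move/convex_setP: (convex_convex_hull (A := scale t A)); apply.
  by move=> x Ax; apply: sub_convex_hull; exists x.
apply: convex_hull_min; last first.
  by move=> _ [x Ax <-]; exists x => //; exact: sub_convex_hull.
apply/convex_setP => _ _ u u01 [x hx <-] [y hy <-].
exists (u *: x + (1 - u) *: y).
  by move/convex_setP: (convex_convex_hull (A := A)); apply.
by rewrite scalerDr !scalerA ![t * _]mulrC.
Qed.

Lemma scaleU t A B : scale t (A `|` B) = scale t A `|` scale t B.
Proof. by rewrite /scale image_setU. Qed.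

Lemma convex_hull_dot_eq A a b : (forall x, A x -> dot a x = b) ->
  forall x, convex_hull A x -> dot a x = b.
Proof.
move=> Aa; apply: (@convex_hull_min _ [set x | dot a x = b]) => //.
by apply/convex_setP => x y t _ /= hx hy; rewrite dotDr !dotZr hx hy; ring.
Qed.

(** A proper convex combination of points with [dot a] at most [b] reaches [b] only if both points
    do. So being below [b], and in the hull of [A]&[H] in case of equality, is a convex condition
    that holds on [A]. *)
Lemma convex_hull_hyperplane A a b : (forall x, A x -> dot a x <= b) ->
  convex_hull A `&` [set x | dot a x = b] =
  convex_hull (A `&` [set x | dot a x = b]).
Proof.
set H := [set x | _ = b] => Aa.
apply/seteqP; split; last first.
  apply: convex_hull_min; last first.
    by move=> x [Ax Hx]; split => //; exact: sub_convex_hull.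
  apply/convex_setP => x y t t01 [hx Hx] [hy Hy]; split.
    by move/convex_setP: (convex_convex_hull (A := A)); apply.
  by rewrite /H/= dotDr !dotZr Hx Hy; ring.
suff : convex_hull A `<=`
    [set x | dot a x <= b /\ (dot a x = b -> convex_hull (A `&` H) x)].
  by move=> sub x [/sub[_]] /[apply].
apply: convex_hull_min; last first.
  by move=> x Ax; split=> [|xb]; [exact: Aa|apply: sub_convex_hull].
apply/convex_setP => x y t /andP[t0 t1] [xb hx] [yb hy]; split.
  by rewrite dotDr !dotZr; nra.
rewrite dotDr !dotZr.
(* For [t] equal to 0 or 1 the point of weight 0 may stay below [b], hence the separate cases. *)
have [->|tn0] := eqVneq t 0.
  by rewrite scale0r subr0 scale1r mul0r mul1r !add0r.
have [->|tn1] := eqVneq t 1.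
  by rewrite subrr !scale0r scale1r mul0r mul1r !addr0.
have t0' : 0 < t by rewrite lt_neqAle eq_sym tn0.
have t1' : t < 1 by rewrite lt_neqAle tn1.
move=> e.
have ex : dot a x = b by apply/eqP; rewrite eq_le xb /=; nra.
have ey : dot a y = b by apply/eqP; rewrite eq_le yb /=; nra.
by move/convex_setP: (convex_convex_hull (A := A `&` H)); apply;
  [rewrite t0 t1|apply: hx|apply: hy].
Qed.

Lemma sub_affine_hull A : A `<=` affine_hull A.
Proof.
move=> x Ax; exists 1%N, (fun=> 1), (fun=> x); split=> //.
  by rewrite big_ord1.
by rewrite big_ord1 scale1r.
Qed.

Lemma affine_hull_line A x y t :
  affine_hull A x -> affine_hull A y -> affine_hull A (t *: x + (1 - t) *: y).
Proof.
move=> [n [w [p [w1 Ap ->]]]] [n' [w' [p' [w'1 Ap' ->]]]].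
exists (n + n')%N.
exists (fun i => match split i with inl j => t * w j | inr j => (1 - t) * w' j end).
exists (fun i => match split i with inl j => p j | inr j => p' j end).
split.
- rewrite big_split_ord/=.
  under eq_bigr => i _ do rewrite (unsplitK (inl i)).
  under [X in _ + X]eq_bigr => i _ do rewrite (unsplitK (inr i)).
  by rewrite -!mulr_sumr w1 w'1; ring.
- by move=> i; case: split.
- rewrite big_split_ord/= !scaler_sumr; congr (_ + _); apply: eq_bigr => i _.
    by rewrite (unsplitK (inl i)) scalerA.
  by rewrite (unsplitK (inr i)) scalerA.
Qed.

(** Computes a dimension from two bounds: all of [A] lies in [x + V], and finitely many directions
    spanning [V] can be followed from [x] inside the affine hull. *)
Lemma has_dim_intro A x (V : {vspace 'rV[R]_d}) (X : seq 'rV[R]_d) :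
    affine_hull A x -> (forall y, A y -> y - x \in V) ->
    (forall v, v \in X -> affine_hull A (x + v)) -> (V <= <<X>>)%VS ->
  has_dim A (\dim V).
Proof.
move=> Ax AV AX VX; exists x, V; split=> //.
apply/seteqP; split.
  move=> _ [n [w [p [w1 Ap ->]]]].
  exists (\sum_(i < n) w i *: (p i - x)).
    by apply: memv_suml => i _; apply/memvZ/AV/Ap.
  under eq_bigr => i _ do rewrite scalerBr.
  by rewrite sumrB -scaler_suml w1 scale1r addrC subrK.
move=> _ [v /= /(subvP VX) vX <-].
(* The midpoint of [x + u] and [x + u'], pushed away from [x] by a factor 2, is [x + (u + u')]. *)
have AD u u' : affine_hull A (x + u) -> affine_hull A (x + u') ->
    affine_hull A (x + (u + u')).
  move=> h h'; have := affine_hull_line (2^-1) h h'.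
  move=> /(affine_hull_line 2)/(_ Ax); congr affine_hull.
  by apply/rowP => i; rewrite !mxE; field.
have AZ t u : affine_hull A (x + u) -> affine_hull A (x + t *: u).
  move=> h; have := affine_hull_line t h Ax; congr affine_hull.
  by apply/rowP => i; rewrite !mxE; ring.
have := coord_span (X := in_tuple X) vX => ->.
elim/big_ind: _ => [||i _]; [by rewrite addr0|exact: AD|].
by apply/AZ/AX; rewrite mem_nth.
Qed.

(** The direction space consists of the differences of points of the affine hull, whatever the base
    point. *)
Lemma has_dim_uniq A n n' : has_dim A n -> has_dim A n' -> n = n'.
Proof.
move=> [x [V [<- AxV]]] [y [W [<- AyW]]].
have step x' y' (V' W' : {vspace 'rV[R]_d}) :
    affine_hull A = [set x' + v | v in [set v | v \in V']] ->
    affine_hull A = [set y' + v | v in [set v | v \in W']] -> (V' <= W')%VS.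
  move=> eV eW; apply/subvP => v vV.
  have : affine_hull A x' by rewrite eV; exists 0; rewrite ?addr0//= mem0v.
  have : affine_hull A (x' + v) by rewrite eV; exists v.
  rewrite eW => -[w1 /= w1W e1] [w2 /= w2W e2].
  have -> : v = w1 - w2.
    by apply/rowP => i; move/rowP: e1 => /(_ i); move/rowP: e2 => /(_ i); rewrite !mxE; lra.
  exact: memvB.
by apply/eqP; rewrite eqn_leq !dimvS//; apply: step; eassumption.
Qed.

(** Excludes the empty set, which [is_face] admits: an empty family of weights cannot sum to 1. *)
Lemma has_dim_nonempty A n : has_dim A n -> A !=set0.
Proof.
move=> [x [V [_ AV]]].
have : affine_hull A x by rewrite AV; exists 0; rewrite ?addr0//= mem0v.
move=> [[|m] [w [p [w1 Ap _]]]]; last by exists (p ord0).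
by move: w1; rewrite big_ord0 => /eqP; rewrite eq_sym oner_eq0.
Qed.

(* The hyperplane of equation [a] misses the origin, so a set of dimension d - 1 inside it
   linearly spans the whole space. *)
Lemma facet_functional_eq0 A n a b a' : has_dim A n -> d = n.+1 -> b != 0 ->
    (forall x, A x -> dot a x = b) -> (forall x, A x -> dot a' x = 0) ->
  a' = 0.
Proof.
move=> [x [V [dV AV]]] dn b0 Aa Aa'.
have aff c e : (forall y, A y -> dot c y = e) -> forall y, affine_hull A y -> dot c y = e.
  move=> Ac _ [m [w [p [w1 Ap ->]]]].
  rewrite (big_morph (dot c) (id1 := 0) (op1 := +%R)); last 2 first.
  - exact: dotDr.
  - by rewrite -(scale0r 0) dotZr mul0r.
  under eq_bigr => i _ do rewrite dotZr Ac//.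
  by rewrite -mulr_suml w1 mul1r.
have Ax : affine_hull A x by rewrite AV; exists 0; rewrite ?addr0//= mem0v.
have ker c e v : (forall y, A y -> dot c y = e) -> v \in V -> dot c v = 0.
  move=> /aff Ac vV; have := Ac _ Ax.
  have : dot c (x + v) = e by apply: Ac; rewrite AV; exists v.
  by rewrite dotDr; lra.
have xV : x \notin V.
  by apply/negP => /(ker _ _ _ Aa); rewrite (aff _ _ Aa)//; exact/eqP.
have full : (V + <[x]>)%VS = fullv.
  apply/eqP; rewrite eqEdim subvf /= dimvf /dim/= mul1n.
  rewrite dimv_disjoint_sum ?dV ?dim_vline; last first.
    apply/eqP; rewrite -subv0; apply/subvP => v /memv_capP[vV /vlineP[t vt]].
    have [t0|t0] := eqVneq t 0; first by rewrite vt t0 scale0r mem0v.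
    case/negP: xV; have -> : x = t^-1 *: v by rewrite vt scalerA mulVf// scale1r.
    exact: memvZ.
  have -> : x != 0 by apply: contraNneq xV => ->; exact: mem0v.
  by rewrite addn1 -dn.
apply/rowP => j; rewrite mxE -(dot_deltar a' j).
have /memv_addP[v vV [_ /vlineP[t ->] ->]] : delta_mx 0 j \in (V + <[x]>)%VS.
  by rewrite full memvf.
by rewrite dotDr dotZr (ker _ _ _ Aa' vV) (aff _ _ Aa' _ Ax) mulr0 addr0.
Qed.

End Hulls.

(** * Faces of the cube *)

Section Cube.
Variables (R : realType) (d : nat).
Implicit Types (A G F S : set 'rV[R]_d) (a x y s c : 'rV[R]_d) (b k : R).

Definition sgv a : 'rV[R]_d := \row_i Num.sg (a 0 i).

Definition supp a : {set 'I_d} := [set i | a 0 i != 0]%SET.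

(** Nonempty faces of the cube are coded by sign vectors, the [s] with [sgv s = s]: nonzero entries
    are the fixed coordinates, zero entries the free ones, and [s] itself is the center of the
    face. *)
Definition cube_face s : set 'rV[R]_d :=
  hypercube R d `&` [set x | forall i, s 0 i != 0 -> x 0 i = s 0 i].

Lemma sgv_id a : sgv (sgv a) = sgv a.
Proof. by apply/rowP => i; rewrite !mxE sgr_id. Qed.

Lemma supp_sgv a : supp (sgv a) = supp a.
Proof. by apply/setP => i; rewrite !inE mxE sgr_eq0. Qed.

Lemma sgv_cases s i : sgv s = s -> s 0 i != 0 -> s 0 i = 1 \/ s 0 i = -1.
Proof.
move=> /rowP/(_ i); rewrite mxE => <-; rewrite sgr_eq0 => s0.
by case: sgrP s0 => // _; [left|right].
Qed.

Lemma cube_face_self s : sgv s = s -> cube_face s s.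
Proof.
move=> ss; split=> // i; move/rowP: ss => /(_ i); rewrite mxE => <-.
by case: sgrP => _; lra.
Qed.

Lemma hypercube_mulr_le a x i : hypercube R d x -> a 0 i * x 0 i <= `|a 0 i|.
Proof.
move=> /(_ i); rewrite -ler_norml => x1.
by apply: le_trans (ler_norm _) _; rewrite normrM ler_piMr.
Qed.

Lemma hypercube_dot_le a x : hypercube R d x -> dot a x <= \sum_i `|a 0 i|.
Proof. by move=> xc; apply: ler_sum => i _; exact: hypercube_mulr_le. Qed.

Lemma dot_sgv a : dot a (sgv a) = \sum_i `|a 0 i|.
Proof. by apply: eq_bigr => i _; rewrite mxE normrEsg mulrC. Qed.

(** Each term of [dot a x] is at most [|a_i|], so equality of the sums forces equality in every
    term. *)
Lemma cube_faceE a :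
  hypercube R d `&` [set x | dot a x = \sum_i `|a 0 i|] = cube_face (sgv a).
Proof.
apply/seteqP; split=> x [xc xa]; split=> //=.
- move=> i; rewrite mxE sgr_eq0 => ai0.
  have : a 0 i * x 0 i = `|a 0 i|.
    apply/eqP; rewrite eq_le hypercube_mulr_le//=.
    have : dot a x = \sum_i `|a 0 i| by [].
    rewrite /dot (bigD1 i)//= [in RHS](bigD1 i)//= => e.
    have : \sum_(j < d | j != i) a 0 j * x 0 j <= \sum_(j < d | j != i) `|a 0 j|.
      by apply: ler_sum => j _; exact: hypercube_mulr_le.
    by move: e; lra.
  by rewrite normrEsg mulrC => /mulIf; apply.
- apply: eq_bigr => i _; have [a0|a0] := eqVneq (a 0 i) 0.
    by rewrite a0 mul0r normr0.
  by rewrite xa mxE ?sgr_eq0// normrEsg mulrC.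
Qed.

Lemma cube_face0 : cube_face 0 = hypercube R d.
Proof. by apply/seteqP; split=> x; [case|split=> //= i; rewrite mxE eqxx]. Qed.

Lemma sgv0 : sgv 0 = 0.
Proof. by apply/rowP => i; rewrite !mxE sgr0. Qed.

Lemma is_face_cube_face s : sgv s = s -> is_face (hypercube R d) (cube_face s).
Proof.
move=> ss; exists s, (\sum_i `|s 0 i|); split; first exact: hypercube_dot_le.
by rewrite -[in LHS]ss -cube_faceE.
Qed.

(** A supporting hyperplane that meets the cube lies at the maximum of [dot a] on it, which is
    attained at [sgv a]. *)
Lemma is_face_hypercube G : is_face (hypercube R d) G -> G !=set0 ->
  exists2 s, sgv s = s & G = cube_face s.
Proof.
move=> [a [b [ab ->]]] [y [yc yb]]; exists (sgv a); first exact: sgv_id.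
rewrite -cube_faceE; have -> // : b = \sum_i `|a 0 i|.
apply/eqP; rewrite eq_le -{1}yb hypercube_dot_le//= -dot_sgv.
by apply: ab; case: (cube_face_self (sgv_id a)).
Qed.

(** The inclusion is decided at the center [s] of the smaller face. *)
Lemma cube_faceS s s' : sgv s = s ->
  cube_face s `<=` cube_face s' <-> forall i, s' 0 i != 0 -> s 0 i = s' 0 i.
Proof.
move=> ss; split=> [/(_ _ (cube_face_self ss))[]//|ss' x [xc xs]].
by split=> // i si; rewrite -ss'//; apply: xs; rewrite ss'.
Qed.

Lemma is_center_cube_face s : is_center (cube_face s) s.
Proof.
move=> x [xc xs]; split=> i /=; last by move=> si; rewrite !mxE xs//; ring.
have {}xc := xc i; rewrite !mxE.
by have [->|/xs <-] := eqVneq (s 0 i) 0; lra.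
Qed.

Lemma cube_face_shift s i e : sgv s = s -> s 0 i = 0 -> -1 <= e <= 1 ->
  cube_face s (s + e *: delta_mx 0 i).
Proof.
move=> ss si e1; split=> j /=; rewrite !mxE; have [->|ji] := eqVneq j i.
- by rewrite si add0r mulr1.
- by rewrite andbF mulr0 addr0; case: (cube_face_self ss).
- by rewrite si eqxx.
- by rewrite andbF mulr0 addr0.
Qed.

Lemma is_center_cube_face_eq s c : sgv s = s -> is_center (cube_face s) c -> c = s.
Proof.
move=> ss cc; apply/rowP => i; have sf := cube_face_self ss.
have [si|si] := eqVneq (s 0 i) 0; last first.
  by case: (cc _ sf) => _ /= /(_ i si); rewrite !mxE; lra.
(* Along a free coordinate, the reflections through [c] of both points [s] plus or minus [e_i] stay
   in the cube, which forces [c_i = 0]. *)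
have [] : cube_face s (2 *: c - (s + 1 *: delta_mx 0 i)) by apply/cc/cube_face_shift => //; lra.
have [] : cube_face s (2 *: c - (s + (-1) *: delta_mx 0 i)) by apply/cc/cube_face_shift => //; lra.
move=> /(_ i) + _ /(_ i) + _; rewrite !mxE !eqxx si mulr1n => h1 h2; lra.
Qed.

(** The direction space is spanned by the [e_i] of the free coordinates, along which the center can
    move by 1. *)
Lemma has_dim_cube_face s : sgv s = s -> has_dim (cube_face s) (d - #|supp s|).
Proof.
move=> ss; pose X := [seq (delta_mx 0 i : 'rV[R]_d) | i <- enum (~: supp s)].
have szX : size X = (d - #|supp s|)%N.
  by rewrite size_map -cardE -[X in (X - _)%N]card_ord -(cardsC (supp s)) addKn.
have XE i : s 0 i = 0 -> delta_mx 0 i \in X.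
  by move=> si; apply: map_f; rewrite mem_enum !inE si eqxx.
have fX : free (in_tuple X).
  have u := enum_uniq (~: supp s).
  apply/freeP => w /rowP w0 i.
  have isz : (i < size (enum (~: supp s)))%N by rewrite -(size_map (delta_mx 0 : _ -> 'rV[R]_d)).
  have [i0 _] : exists i0 : 'I_d, True by case: (enum _) isz => // j; exists j.
  have := w0 (nth i0 (enum (~: supp s)) i).
  rewrite summxE (bigD1 i)//= big1 ?addr0 => [|j ji].
    by rewrite !mxE (nth_map i0)// mxE !eqxx mulr1.
  have jsz : (j < size (enum (~: supp s)))%N by rewrite -(size_map (delta_mx 0 : _ -> 'rV[R]_d)).
  by rewrite mxE (nth_map i0)// mxE nth_uniq// val_eqE [i == j]eq_sym (negPf ji) andbF mulr0.
rewrite -szX; move: (fX); rewrite /free => /eqP <-.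
apply: (@has_dim_intro _ _ _ s _ X) => //.
- by apply: sub_affine_hull; exact: cube_face_self.
- move=> y [_ ys]; rewrite (row_sum_delta (y - s)); apply: memv_suml => i _.
  have [si|si] := eqVneq (s 0 i) 0; first by apply/memvZ/memv_span/XE.
  by rewrite !mxE ys// subrr scale0r mem0v.
- move=> v /mapP[i + ->]; rewrite mem_enum !inE negbK => /eqP si.
  apply: sub_affine_hull; rewrite -[delta_mx 0 i]scale1r.
  by apply: cube_face_shift => //; lra.
Qed.

Lemma supp0 : supp 0 = finset.set0 :> {set 'I_d}.
Proof. by apply/setP => i; rewrite !inE mxE eqxx. Qed.

Lemma has_dim_hypercube : has_dim (hypercube R d) d.
Proof. by have := has_dim_cube_face sgv0; rewrite supp0 cards0 subn0 cube_face0. Qed.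

Lemma sgv_facet s i : sgv s = s ->
  sgv (s 0 i *: delta_mx 0 i) = s 0 i *: delta_mx 0 i.
Proof.
move=> /rowP/(_ i) ss; apply/rowP => j; rewrite !mxE sgrM; rewrite mxE in ss.
by rewrite ss; case: (_ && _); rewrite ?sgr1 ?sgr0.
Qed.

Lemma cube_face_inj s s' : sgv s = s -> cube_face s = cube_face s' -> s' = s.
Proof.
by move=> ss e; apply: is_center_cube_face_eq => //; rewrite e; exact: is_center_cube_face.
Qed.

(** By dimension a facet fixes a single coordinate [i]; it contains the face exactly when the face
    fixes [i] to the same value. *)
Lemma facets_containing_cube_face s : sgv s = s ->
  facets_containing (hypercube R d) (cube_face s) =
  (fun i => cube_face (s 0 i *: delta_mx 0 i)) @` [set i | s 0 i != 0].
Proof.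
move=> ss; apply/seteqP; split.
  move=> F [[fF [n [hn Fn]]] sF].
  have [s' ss' eF] := is_face_hypercube fF (has_dim_nonempty Fn).
  have dn := has_dim_uniq hn has_dim_hypercube.
  move: Fn; rewrite eF => /has_dim_uniq/(_ (has_dim_cube_face ss')) nE.
  have /cards1P[i si'] : #|supp s'| == 1%N.
    have := max_card (mem (supp s')); rewrite card_ord => h.
    by rewrite -(subKn h) -nE -[in X in (X - _)%N]dn subSnn.
  move: sF; rewrite eF => /(cube_faceS _ ss) h.
  have s'i : s' 0 i != 0 by move/setP: si' => /(_ i); rewrite !inE eqxx.
  exists i; first by rewrite /= h.
  congr cube_face; apply/rowP => j; rewrite !mxE.
  have [->|ji] := eqVneq j i; first by rewrite mulr1 h.
  rewrite andbF mulr0; move/setP: si' => /(_ j); rewrite !inE (negPf ji).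
  by move/negbFE/eqP.
move=> _ [i /= si <-].
have ssi := sgv_facet i ss.
have suppi : supp (s 0 i *: delta_mx 0 i) = [set i]%SET.
  by apply/setP => j; rewrite !inE !mxE mulf_eq0 negb_or si pnatr_eq0 eqb0 negbK.
split; last first.
  apply/cube_faceS => // j; rewrite !mxE; have [->|ji] := eqVneq j i.
    by rewrite eqxx mulr1.
  by rewrite andbF mulr0 eqxx.
split; first exact: is_face_cube_face.
have d0 : (0 < d)%N by apply: leq_ltn_trans (ltn_ord i).
exists d.-1; split; first by rewrite prednK//; exact: has_dim_hypercube.
by have := has_dim_cube_face ssi; rewrite suppi cards1 subn1.
Qed.

Lemma pulled_points_cube_face k s : sgv s = s ->
  pulled_points k (cube_face s) =
  (fun i => (k * s 0 i) *: delta_mx 0 i) @` [set i | s 0 i != 0].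
Proof.
move=> ss; rewrite /pulled_points facets_containing_cube_face//.
apply/seteqP; split.
  move=> _ [_ [c [[i si <-] /(is_center_cube_face_eq (sgv_facet i ss)) -> ->]]].
  by exists i => //; rewrite scalerA.
move=> _ [i si <-]; exists (cube_face (s 0 i *: delta_mx 0 i)), (s 0 i *: delta_mx 0 i).
by split; [exists i|exact: is_center_cube_face|rewrite scalerA].
Qed.

End Cube.

(** * Facets of the hull of the cube and the pulled points *)

Lemma card_finset (T : finType) (A : {set T}) : [set x | x \in A] #= `I_#|A|.
Proof.
have -> : [set x | x \in A] = (@enum_val T (mem A)) @` [set: 'I_#|A|].
  apply/seteqP; split=> [x xA|_ [i _ <-]]; last exact: enum_valP.
  by exists (enum_rank_in xA x) => //; rewrite enum_rankK_in.
apply: card_eq_trans (inj_card_eq _) _; first by move=> i j _ _; exact: enum_val_inj.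
by rewrite card_eq_sym card_II.
Qed.

Section Facets.
Variables (R : realType) (d : nat).
Implicit Types (A G F S : set 'rV[R]_d) (a x y s c : 'rV[R]_d) (b k : R).

(** The hyperplane misses the origin, so its direction space has dimension below [d]. Conversely the
    differences [y - x] together with [x] span everything, so they alone span at least [d - 1]
    dimensions. *)
Lemma has_dim_hyperplane A a b x (Y : seq 'rV[R]_d) : b != 0 ->
    (forall y, A y -> dot a y = b) -> A x -> (forall y, y \in Y -> A y) ->
    (forall j, delta_mx 0 j \in <<Y>>%VS) ->
  has_dim A d.-1.
Proof.
move=> b0 Aa Ax YA Yfull.
pose V := lker (linfun (mulmxr a^T : 'rV[R]_d -> 'rV_1)).
have VE v : (v \in V) = (dot a v == 0).
  have vE : dot a v = (v *m a^T) 0 0.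
    by rewrite mxE; apply: eq_bigr => i _; rewrite mxE mulrC.
  rewrite memv_ker lfunE/= vE; apply/eqP/eqP => [->|e]; first by rewrite mxE.
  by apply/rowP => i; rewrite ord1 e mxE.
pose X := [seq y - x | y <- Y].
have XV : (<<X>> <= V)%VS.
  by apply/span_subvP => _ /mapP[y /YA Ay ->]; rewrite VE dotDr dotNr !Aa// subrr.
have dimX : (d <= \dim <<X>> + 1)%N.
  have full : (<<X>> + <[x]>)%VS = fullv.
    apply/eqP; rewrite eqEsubv subvf; apply/subvP => v _.
    suff /subvP YX : (<<Y>> <= <<X>> + <[x]>)%VS.
      by rewrite (row_sum_delta v); apply: memv_suml => i _; apply/memvZ/YX/Yfull.
    apply/span_subvP => y yY; rewrite -(subrK x y) memv_add ?memv_line//.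
    by apply: memv_span; apply: map_f.
  have := dimv_add_leqif <<X>>%VS <[x]>%VS; rewrite full => -[+ _].
  rewrite dimvf /dim/= mul1n => /leq_trans; apply.
  by rewrite leq_add2l dim_vline leq_b1.
have dimV : (\dim V < d)%N.
  have := dimvS (subvf V); rewrite dimvf /dim/= mul1n leq_eqVlt => /orP[/eqP e|//].
  have : x \in V.
    have -> : V = fullv by apply/eqP; rewrite eqEdim subvf/= dimvf /dim/= mul1n e.
    exact: memvf.
  by rewrite VE Aa// (negPf b0).
have d0 : (0 < d)%N by apply: leq_ltn_trans dimV.
have dVE : \dim V = d.-1.
  apply/eqP; rewrite eqn_leq -ltnS prednK// dimV/= -ltnS prednK//.
  by apply: leq_trans dimX _; rewrite addn1 ltnS dimvS.
rewrite -dVE; apply: (@has_dim_intro _ _ _ x _ X).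
- exact: sub_affine_hull.
- by move=> y Ay; rewrite VE dotDr dotNr !Aa// subrr.
- by move=> v /mapP[y /YA Ay ->]; rewrite addrC subrK; exact: sub_affine_hull.
- suff -> : <<X>>%VS = V by [].
  apply/eqP; rewrite eqEdim XV dVE /= -ltnS prednK//.
  by rewrite -addn1.
Qed.

(** For a sign vector [a] and [J] its support, these are the pulled points of [cube_face a]; a
    smaller [J] selects some of them. *)
Definition pulled (k : R) a (J : set 'I_d) : set 'rV[R]_d :=
  (fun i => (k * a 0 i) *: delta_mx 0 i) @` J.

Lemma pulled_coord k a i j :
  ((k * a 0 i) *: delta_mx 0 i : 'rV[R]_d) 0 j = if j == i then k * a 0 i else 0.
Proof. by rewrite !mxE eqxx/=; case: eqP => _; rewrite ?mulr1 ?mulr0. Qed.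

Lemma pulled_inj k a : k != 0 -> {in [set i | a 0 i != 0] &,
  injective (fun i => (k * a 0 i) *: delta_mx 0 i : 'rV[R]_d)}.
Proof.
move=> k0 i j /set_mem/= ai _ /rowP/(_ i).
rewrite !pulled_coord eqxx; case: eqP => // _ /eqP.
by rewrite mulf_eq0 (negPf k0) (negPf ai).
Qed.

Lemma card_pulled k a (J : {set 'I_d}) : k != 0 -> J \subset supp a ->
  pulled k a [set i | i \in J] #= `I_#|J|.
Proof.
move=> k0 /fintype.subsetP Ja; apply: card_eq_trans (card_finset J).
have aJ i : i \in J -> i \in ([set i | a 0 i != 0] : set 'I_d).
  by move=> /Ja; rewrite inE => ai; exact/mem_set.
apply: inj_card_eq => i j /set_mem/aJ ai /set_mem/aJ aj.
exact: (@pulled_inj k a k0).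
Qed.

(** Nonzero multiples of distinct basis vectors are linearly independent, hence affinely
    independent. *)
Lemma is_simplex_pulled k a n (J : {set 'I_d}) : k != 0 -> J \subset supp a ->
    #|J| = n.+1 ->
  is_simplex n (pulled k a [set i | i \in J]) (convex_hull (pulled k a [set i | i \in J])).
Proof.
move=> k0 Ja Jn; pose e (i : 'I_n.+1) := enum_val (cast_ord (esym Jn) i).
have einj : injective e by move=> i j /enum_val_inj/cast_ord_inj.
have ea i : a 0 (e i) != 0.
  by have := fintype.subsetP Ja _ (enum_valP (cast_ord (esym Jn) i)); rewrite inE.
exists (fun i => (k * a 0 (e i)) *: delta_mx 0 (e i)); split=> //.
  move=> w _ /rowP w0 i; have := w0 (e i).
  rewrite summxE (bigD1 i)//= big1 ?addr0 => [|j ji].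
    rewrite mxE pulled_coord eqxx mxE => /eqP.
    by rewrite !mulf_eq0 (negPf k0) (negPf (ea i)) !orbF => /eqP.
  by rewrite mxE pulled_coord (inj_eq einj) eq_sym (negPf ji) mulr0.
apply/seteqP; split=> _ [i Ji <-]; last by exists (e i) => //; exact: enum_valP.
exists (cast_ord Jn (enum_rank_in Ji i)) => //.
by rewrite /e cast_ordK enum_rankK_in.
Qed.

(** The points correspond bijectively to their indices, so [S] uses [n] of the [n + 1] indices and
    [j0] is the one left out. *)
Lemma pulled_sub_card k a S n : k != 0 -> S `<=` pulled k a [set i | a 0 i != 0] ->
    S #= `I_n -> #|supp a| = n.+1 ->
  exists j0, a 0 j0 != 0 /\ S = pulled k a [set i | i \in (supp a :\ j0)%SET].
Proof.
move=> k0 Sa Sn an.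
pose J := [set i in supp a | `[< S ((k * a 0 i) *: delta_mx 0 i) >]]%SET.
have Jsub : J \subset supp a by apply/fintype.subsetP => i; rewrite inE => /andP[].
have SJ : S = pulled k a [set i | i \in J].
  apply/seteqP; split=> [x Sx|_ [i /= + <-]].
    have [i ai xE] := Sa _ Sx; exists i => //=.
    by rewrite !inE; apply/andP; split=> //; apply/asboolP; rewrite xE.
  by rewrite inE => /andP[_ /asboolP].
have Jn : #|J| = n.
  apply/card_eq_II; apply: card_eq_trans Sn; rewrite SJ card_eq_sym.
  exact: card_pulled.
have /cards1P[j0 Dj0] : #|(supp a :\: J)%SET| == 1%N.
  by rewrite cardsDS// an Jn subSnn.
have : j0 \in (supp a :\: J)%SET by rewrite Dj0 inE.
rewrite inE => /andP[j0J]; rewrite inE => aj0.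
have JE : J = (supp a :\ j0)%SET.
  by rewrite -Dj0 finset.setDDr finset.setDv finset.set0U (finset.setIidPr Jsub).
by exists j0; rewrite -JE.
Qed.

Definition vertices k : set 'rV[R]_d :=
  [set x | exists j, x = k *: delta_mx 0 j \/ x = - (k *: delta_mx 0 j)].

Lemma scale_rho k : k != 0 ->
  scale k (rho d k) = convex_hull (vertices k `|` hypercube R d).
Proof.
move=> k0; rewrite /rho scale_convex_hull scaleU scale_convex_hull convex_hullUl.
congr (convex_hull (_ `|` _)); apply/seteqP; split.
- by move=> _ [_ [j [] ->] <-]; exists j; [left|right; rewrite scalerN].
- move=> _ [j [] ->]; first by exists (delta_mx 0 j) => //; exists j; left.
  by exists (- delta_mx 0 j); [exists j; right|rewrite scalerN].
- by move=> _ [_ [x xc <-] <-]; rewrite scalerA divff// scale1r.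
- move=> x xc; exists (k^-1 *: x); first by exists x.
  by rewrite scalerA divff// scale1r.
Qed.

Lemma scale_rho_bound k a b : 0 < k ->
  (forall x, scale k (rho d k) x -> dot a x <= b) <->
  (forall j, k * `|a 0 j| <= b) /\ \sum_i `|a 0 i| <= b.
Proof.
move=> k0; rewrite scale_rho ?gt_eqF//; split=> [h|[h1 h2]].
  have {}h x : (vertices k `|` hypercube R d) x -> dot a x <= b.
    by move=> hx; apply: h; exact: sub_convex_hull.
  split=> [j|].
    have h1 : dot a (k *: delta_mx 0 j) <= b by apply: h; left; exists j; left.
    have h2 : dot a (- (k *: delta_mx 0 j)) <= b by apply: h; left; exists j; right.
    move: h1 h2; rewrite dotNr dotZr dot_deltar.
    by case: (ger0P (a 0 j)) => _; rewrite ?mulrN.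
  by rewrite -dot_sgv; apply: h; right; case: (cube_face_self (sgv_id a)).
apply: convex_hull_min; first exact: convex_halfspace.
move=> x [[j [] ->]|xc] /=.
- rewrite dotZr dot_deltar; apply: le_trans (h1 j).
  by apply: ler_wpM2l; [exact: ltW|exact: ler_norm].
- rewrite dotNr dotZr dot_deltar -mulrN; apply: le_trans (h1 j).
  by apply: ler_wpM2l; [exact: ltW|rewrite -normrN ler_norm].
- exact: le_trans (hypercube_dot_le _ xc) h2.
Qed.

Lemma vertices_face k a : 0 < k ->
  vertices k `&` [set x | dot a x = k] = pulled k (sgv a) [set i | `|a 0 i| = 1].
Proof.
move=> k0; have kn0 : k != 0 by rewrite gt_eqF.
have cancel_k t : k * t = k -> t = 1.
  by move=> e; apply: (mulfI kn0); rewrite mulr1.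
apply/seteqP; split=> [x [[j [] ->]]|_ [i /= ai <-]].
- rewrite /= dotZr dot_deltar => /cancel_k aj; exists j => /=; rewrite ?mxE aj ?normr1//.
  by rewrite sgr1 mulr1.
- rewrite /= dotNr dotZr dot_deltar -mulrN => /cancel_k aj; exists j => /=.
    by rewrite -normrN aj normr1.
  by rewrite mxE -[a 0 j]opprK aj sgrN sgr1 mulrN1 scaleNr.
- split=> /=.
    exists i; rewrite mxE; case: sgrP ai => [_ /eqP|_ _|_ _].
    + by rewrite eq_sym oner_eq0.
    + by left; rewrite mulr1.
    + by right; rewrite mulrN1 scaleNr.
  by rewrite dotZr dot_deltar mxE -mulrA -normrEsg ai mulr1.
Qed.

Lemma scale_rho_face k a : 0 < k -> (forall j, `|a 0 j| <= 1) ->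
    \sum_i `|a 0 i| <= k ->
  scale k (rho d k) `&` [set x | dot a x = k] =
  convex_hull (pulled k (sgv a) [set i | `|a 0 i| = 1] `|`
               (hypercube R d `&` [set x | dot a x = k])).
Proof.
move=> k0 a1 ak.
have h : forall x, scale k (rho d k) x -> dot a x <= k.
  by apply/scale_rho_bound => //; split=> // j; rewrite ler_piMr// ltW.
move: h; rewrite scale_rho ?gt_eqF// => h.
rewrite convex_hull_hyperplane.
  by rewrite setIUl vertices_face.
by move=> x hx; apply: h; exact: sub_convex_hull.
Qed.

Lemma has_dim_scale_rho k : 0 < k -> has_dim (scale k (rho d k)) d.
Proof.
move=> k0; rewrite scale_rho ?gt_eqF//.
have inP x : hypercube R d x -> affine_hull (convex_hull (vertices k `|` hypercube R d)) x.
  by move=> xc; apply: sub_affine_hull; apply: sub_convex_hull; right.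
have dE : \dim (fullv : {vspace 'rV[R]_d}) = d by rewrite dimvf /dim/= mul1n.
rewrite -[X in has_dim _ X]dE.
apply: (@has_dim_intro _ _ _ 0 _ [seq delta_mx 0 j | j <- enum 'I_d]).
- by apply: inP => i; rewrite mxE; lra.
- by move=> *; exact: memvf.
- move=> v /mapP[j _ ->]; rewrite add0r; apply: inP => i.
  by rewrite mxE eqxx/=; case: eqP => _ /=; lra.
- apply/subvP => v _; rewrite (row_sum_delta v); apply: memv_suml => i _.
  by apply/memvZ/memv_span/map_f; rewrite mem_enum.
Qed.

End Facets.

(** * Normal vectors of the facets *)

Section FacetNormals.
Variables (R : realType) (d : nat).
Implicit Types (F : set 'rV[R]_d) (a : 'rV[R]_d) (k : R).

(* The normal vectors of the facets, scaled so that the facet lies at height k: m entries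
   are +-1, one entry is +-(k - m) and the others vanish. *)
Definition facet_normal k a j0 :=
  [/\ 0 < `|a 0 j0| < 1, forall i, i != j0 -> a 0 i = 0 \/ `|a 0 i| = 1 &
      \sum_i `|a 0 i| = k].

Lemma facet_normal_sum k a j0 : facet_normal k a j0 ->
  k = `|a 0 j0| + #|(supp a :\ j0)%SET|%:R.
Proof.
move=> [_ a01 <-]; rewrite (bigD1 j0)//=; congr (_ + _).
rewrite -sumr_const big_mkcond [RHS]big_mkcond; apply: eq_bigr => i _.
rewrite !inE; case: eqP => //= /eqP ij.
by have [->|ai] := a01 i ij; [rewrite normr0 eqxx|rewrite ai -normr_gt0 ai ltr01].
Qed.

(** [|a_j0|] lies strictly between 0 and 1 and differs from [k] by the number of the other nonzero
    entries, so that number is the integer part of [k]. *)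
Lemma facet_normal_card_supp k a j0 : facet_normal k a j0 ->
  #|(supp a :\ j0)%SET| = Num.truncn k /\ #|supp a| = (Num.truncn k).+1.
Proof.
move=> ha; have [/andP[a0 a1] _ _] := ha.
have e : #|(supp a :\ j0)%SET| = Num.truncn k.
  apply/esym/truncn_def; rewrite (facet_normal_sum ha) lerDr ltW//=.
  by rewrite -natr1 addrC ltrD2l.
by split=> //; rewrite (cardsD1 j0) e inE -normr_gt0 a0.
Qed.

Lemma facet_normal_face k a j0 : 0 < k -> facet_normal k a j0 ->
  scale k (rho d k) `&` [set x | dot a x = k] =
  convex_hull (cube_face (sgv a) `|` pulled k (sgv a) [set i | i \in (supp a :\ j0)%SET]).
Proof.
move=> k0 [/andP[a0 a1] a01 ak].
rewrite scale_rho_face ?ak// => [|j]; last first.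
  have [->|/a01[->|->]//] := eqVneq j j0; first exact: ltW.
  by rewrite normr0.
rewrite -[in X in _ `&` X]ak cube_faceE setUC; congr (convex_hull (_ `|` pulled _ _ _)).
apply/seteqP; split=> i /=; rewrite !inE.
  move=> ai; rewrite -normr_gt0 ai ltr01 andbT.
  by apply: contraTneq a1 => <-; rewrite ai ltxx.
by move=> /andP[/a01[->|]//]; rewrite eqxx.
Qed.

(** The hyperplane supports the polytope; that the face has dimension [d - 1] follows by exhibiting
    points of it that linearly span the space. *)
Lemma is_facet_facet_normal k a j0 : 0 < k -> facet_normal k a j0 ->
  is_facet (scale k (rho d k)) (scale k (rho d k) `&` [set x | dot a x = k]).
Proof.
move=> k0 ha; have [/andP[a0 a1] a01 ak] := ha.
have a_le1 j : `|a 0 j| <= 1.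
  have [->|/a01[->|->]//] := eqVneq j j0; first exact: ltW.
  by rewrite normr0.
split.
  exists a, k; split=> //; apply/scale_rho_bound => //; rewrite ak; split=> // j.
  by rewrite ler_piMr// ltW.
have d0 : (0 < d)%N by apply: leq_ltn_trans (ltn_ord j0).
exists d.-1; split; first by rewrite prednK//; exact: has_dim_scale_rho.
pose s := sgv a; have s0 i : (s 0 i != 0) = (i \in supp a) by rewrite mxE sgr_eq0 inE.
(* The center of the cube face, its shifts along the free coordinates, and the pulled points.
   Subtracting the center from the shifts gives the free [e_i]; the pulled points give the [e_i] of
   the support other than [e_j0]. *)
pose Y := s :: [seq s + delta_mx 0 i | i <- enum (~: supp a)] ++
  [seq (k * s 0 i) *: delta_mx 0 i | i <- enum (supp a :\ j0)].
apply: (@has_dim_hyperplane _ _ _ a k s Y); first by rewrite gt_eqF.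
- by move=> y [].
- rewrite (facet_normal_face k0 ha); apply: sub_convex_hull; left.
  exact: cube_face_self (sgv_id a).
- rewrite (facet_normal_face k0 ha) => y; rewrite inE mem_cat => /orP[/eqP ->|/orP[]].
  + by apply: sub_convex_hull; left; exact: cube_face_self (sgv_id a).
  + move=> /mapP[i + ->]; rewrite mem_enum inE -s0 negbK => /eqP si.
    apply: sub_convex_hull; left; rewrite -[delta_mx 0 i]scale1r.
    by apply: cube_face_shift => //; [exact: sgv_id|lra].
  + move=> /mapP[i + ->]; rewrite mem_enum => ij.
    by apply: sub_convex_hull; right; exists i.
have sY : s \in <<Y>>%VS by apply: memv_span; rewrite inE eqxx.
have Yi i : i != j0 -> delta_mx 0 i \in <<Y>>%VS.
  move=> ij; have [ia|ia] := boolP (i \in supp a).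
    have ks : k * s 0 i != 0 by apply: mulf_neq0; rewrite ?s0// gt_eqF.
    have : (k * s 0 i) *: delta_mx 0 i \in <<Y>>%VS.
      apply: memv_span; rewrite inE mem_cat; apply/orP; right; apply/orP; right.
      by apply: map_f; rewrite mem_enum !inE ij; move: ia; rewrite inE.
    by rewrite rpredZeq (negPf ks).
  rewrite -(addKr s (delta_mx 0 i)) addrC memvB//.
  apply: memv_span; rewrite inE mem_cat; apply/orP; right; apply/orP; left.
  by apply: map_f; rewrite mem_enum inE.
move=> j; have [->|/Yi//] := eqVneq j j0.
have sj0 : s 0 j0 != 0 by rewrite s0 inE -normr_gt0.
suff : s 0 j0 *: delta_mx 0 j0 \in <<Y>>%VS by rewrite rpredZeq (negPf sj0).
(* The last direction is what remains of the center once the other coordinates are removed. *)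
have -> : s 0 j0 *: delta_mx 0 j0 = s - \sum_(i | i != j0) s 0 i *: delta_mx 0 i.
  have e := row_sum_delta s; rewrite (bigD1 j0)//= in e.
  by rewrite [X in _ = X - _]e addrK.
by apply: memvB => //; apply: memv_suml => i /Yi; exact: memvZ.
Qed.

Lemma is_facet_scale_rho k F : 0 < k -> k < d%:R -> k \isn't a Num.int ->
    is_facet (scale k (rho d k)) F ->
  exists a j0, facet_normal k a j0 /\ F = scale k (rho d k) `&` [set x | dot a x = k].
Proof.
move=> k0 kd kint [[a [b [ab FE]]] [n [hP hF]]].
have dn : d = n.+1 := has_dim_uniq (has_dim_scale_rho d k0) hP.
have [ka sa] := (scale_rho_bound a b k0).1 ab.
(* [b = 0] would force [a = 0], making [F] the whole polytope. *)
have b0 : 0 < b.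
  rewrite lt_neqAle (le_trans _ sa) ?sumr_ge0// andbT eq_sym.
  apply/eqP => b0.
  have a0 : a = 0.
    apply/rowP => j; rewrite mxE; apply/eqP; rewrite -normr_le0.
    by have := ka j; rewrite b0 pmulr_rle0.
  have FP : F = scale k (rho d k).
    rewrite FE; apply/seteqP; split=> [x []//|x Px]; split=> //.
    by rewrite b0; apply: big1 => i _; rewrite a0 mxE mul0r.
  by move: hF; rewrite FP => /(has_dim_uniq hP)/eqP; rewrite gtn_eqF.
have kb0 : 0 < k / b by rewrite divr_gt0.
(* Rescaling to height [k] turns the bounds [k |a_j| <= b] into [|c_j| <= 1]. *)
pose c := (k / b) *: a.
have cE j : `|c 0 j| = k * `|a 0 j| / b.
  by rewrite mxE normrM gtr0_norm// mulrAC.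
have c1 j : `|c 0 j| <= 1 by rewrite cE ler_pdivrMr// mul1r.
have ck : \sum_i `|c 0 i| <= k.
  under eq_bigr => i _ do rewrite cE mulrAC.
  by rewrite -mulr_sumr mulrAC ler_pdivrMr// ler_wpM2l// ltW.
have {}FE : F = scale k (rho d k) `&` [set x | dot c x = k].
  rewrite FE; congr (_ `&` _); apply/seteqP.
  have cx x : dot c x = k / b * dot a x by rewrite dotC dotZr dotC.
  split=> x /=; rewrite cx.
    by rewrite /dot => ->; rewrite divfK// gt_eqF.
  move=> /(canRL (mulKf (lt0r_neq0 kb0))); rewrite /dot => ->.
  by rewrite invf_div divfK// gt_eqF.
clearbody c.
have Fk x : F x -> dot c x = k by rewrite FE => -[].
have F0 e : (forall x, F x -> dot e x = 0) -> e = 0.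
  by apply: (facet_functional_eq0 hF dn _ Fk); rewrite gt_eqF.
have FE' := FE; rewrite scale_rho_face// in FE'.
(* [F] is the hull of the pulled points with [|c_i| = 1] and of its part in the cube, so a
   functional need only vanish on these to be 0. *)
have {}F0 (e : 'rV[R]_d) : (forall i, `|c 0 i| = 1 -> e 0 i = 0) ->
    (forall x, hypercube R d x -> dot c x = k -> dot e x = 0) -> e = 0.
  move=> h1 h2; apply: F0; rewrite FE'; apply: convex_hull_dot_eq.
  move=> x [[i /= ci <-]|[xc xk]]; last exact: h2.
  by rewrite dotZr dot_deltar h1// mulr0.
(* If the sum were smaller, [F] would contain no point of the cube, and [e_j] would vanish on [F]
   for any [j] with [|c_j| < 1]. Such a [j] exists, since otherwise the sum would be [d > k]. *)
have {}ck : \sum_i `|c 0 i| = k.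
  apply/eqP; rewrite eq_le ck/= leNgt; apply/negP => cltk.
  have [/existsP[j cj]|/existsPn c1'] := boolP [exists j, `|c 0 j| != 1]; last first.
    move: cltk; under eq_bigr => i _ do rewrite (eqP (negbNE (c1' i))).
    by rewrite sumr_const card_ord ltNge (ltW kd).
  have : delta_mx 0 j = 0 :> 'rV[R]_d.
    apply: F0 => [i ci|x /(hypercube_dot_le c) xc xk].
      by rewrite mxE eqxx/=; case: eqP => // ij; move: cj; rewrite -ij ci eqxx.
    by move: cltk; rewrite ltNge -xk xc.
  by move=> /rowP/(_ j)/eqP; rewrite !mxE !eqxx oner_eq0.
(* If every [|c_i|] were 0 or 1, their sum [k] would be an integer. *)
have [j0 cj0] : exists j0, 0 < `|c 0 j0| < 1.
  apply/existsP; apply: contraNT kint => /existsPn c01.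
  rewrite -ck; apply: rpred_sum => i _; have := c01 i.
  rewrite negb_and -leNgt normr_le0 -leNgt => /orP[/eqP ->|h].
    by rewrite normr0 rpred0.
  by have -> : `|c 0 i| = 1; [apply/eqP; rewrite eq_le c1|rewrite rpred1].
exists c, j0; split=> //; split=> // i ij.
have [ci0|ci0] := eqVneq (c 0 i) 0; [by left|right]; apply/eqP/negPn/negP => ci1.
(* With two fractional entries [i] and [j0], this functional, which moves weight between them,
   vanishes on [F]: neither index has a pulled point on [F], and on the cube part [x_i] and [x_j0]
   are the signs of [c_i] and [c_j0], giving [1 - 1]. *)
have /rowP/(_ i) :
    Num.sg (c 0 i) *: delta_mx 0 i - Num.sg (c 0 j0) *: delta_mx 0 j0 = 0 :> 'rV[R]_d.
  apply: F0 => [l cl|x xc].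
    have li : l != i by apply: contraNneq ci1 => <-; rewrite cl.
    have lj : l != j0 by apply: contraTneq cj0 => <-; rewrite cl ltxx andbF.
    by rewrite !mxE (negPf li) (negPf lj) !andbF !mulr0 subrr.
  rewrite -ck => xk.
  have [_ xs] : cube_face (sgv c) x by rewrite -cube_faceE.
  have cj0' : c 0 j0 != 0 by rewrite -normr_gt0; case/andP: cj0.
  have sgsq t : t != 0 -> Num.sg t * Num.sg t = 1 :> R.
    by move=> t0; rewrite -expr2 sqr_sg t0.
  have xE l : c 0 l != 0 -> x 0 l = Num.sg (c 0 l).
    by move=> cl; rewrite xs mxE// sgr_eq0.
  by rewrite dotC dotDr dotNr !dotZr !dot_deltar !xE// !sgsq// subrr.
rewrite !mxE !eqxx (negPf ij)/= mulr0 subr0 mulr1 => /eqP.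
by rewrite sgr_eq0 (negPf ci0).
Qed.

End FacetNormals.

(** Shrinking the entry [j0] of [s] by the factor [t] keeps all signs and makes the absolute values
    sum to [k]. *)
Lemma facet_normal_of_sgv (R : realType) (d : nat) (k t : R) (s : 'rV[R]_d) (j0 : 'I_d) :
    sgv s = s -> s 0 j0 != 0 -> 0 < t < 1 -> k = t + #|(supp s :\ j0)%SET|%:R ->
  exists2 a, facet_normal k a j0 & sgv a = s.
Proof.
move=> ss sj0 /andP[t0 t1] kE.
have s1 i : s 0 i != 0 -> `|s 0 i| = 1.
  by move=> /(sgv_cases ss)[] ->; rewrite ?normrN normr1.
exists (\row_i (if i == j0 then t * s 0 i else s 0 i)).
  split=> [|i ij|].
  - by rewrite mxE eqxx normrM s1// mulr1 gtr0_norm// t0.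
  - by rewrite mxE (negPf ij); have [|/s1] := eqVneq (s 0 i) 0; [left|right].
  - rewrite (bigD1 j0)//= mxE eqxx normrM s1// mulr1 gtr0_norm// kE; congr (_ + _).
    rewrite -sumr_const big_mkcond [RHS]big_mkcond; apply: eq_bigr => i _.
    rewrite !inE mxE; case: eqP => //= _.
    by have [->|/s1//] := eqVneq (s 0 i) 0; rewrite normr0.
apply/rowP => i; rewrite !mxE -[RHS](congr1 (fun v : 'rV_d => v 0 i) ss) mxE.
by case: eqP => // _; rewrite sgrM gtr0_sg// mul1r.
Qed.

Theorem theorem2p3 (R : realType) (d : nat) (k : R)
    (d_ge1 : (1 <= d)%N) (k_ge1 : 1 <= k) (k_led : k <= d%:R)
    (k_nonint : k \isn't a Num.int) :
  let m := Num.truncn k in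
  (forall G : set 'rV[R]_d,
     is_face (hypercube R d) G -> has_dim G (d - m - 1)%N ->
     [/\ facets_containing (hypercube R d) G #= `I_m.+1,
         pulled_points k G #= `I_m.+1 &
         forall S : set 'rV[R]_d, S `<=` pulled_points k G -> S #= `I_m ->
           is_simplex m.-1 S (convex_hull S)]) /\
  (forall F : set 'rV[R]_d,
     is_facet (scale k (rho d k)) F <->
     exists G S alpha : set 'rV[R]_d,
       [/\ is_face (hypercube R d) G /\ has_dim G (d - m - 1)%N,
           S `<=` pulled_points k G,
           S #= `I_m,
           is_simplex m.-1 S alpha &
           F = convex_hull (G `|` alpha)]).
Proof.
move=> m.
have k0 : 0 < k by apply: lt_le_trans k_ge1.
have kn0 : k != 0 by rewrite gt_eqF.
have /andP[mk km] : m%:R <= k < m.+1%:R by apply: truncn_itv; exact: ltW.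
have {}mk : m%:R < k.
  rewrite lt_neqAle mk andbT; apply: contraNneq k_nonint => <-.
  exact: rpred_nat.
have kd : k < d%:R.
  rewrite lt_neqAle k_led andbT; apply: contraNneq k_nonint => ->.
  exact: rpred_nat.
have md : (m < d)%N by rewrite -(ltr_nat R); apply: lt_trans kd.
(* Ensures that [m.-1] is a true predecessor, so a simplex of dimension [m.-1] has [m] vertices. *)
have m0 : (0 < m)%N by rewrite truncn_gt0.
(* As [m < d], the subtraction is not truncated, and the dimension determines the number [m + 1] of
   fixed coordinates. *)
have face_sgv G : is_face (hypercube R d) G -> has_dim G (d - m - 1)%N ->
    exists s, [/\ sgv s = s, G = cube_face s & #|supp s| = m.+1].
  move=> fG hG; have [s ss GE] := is_face_hypercube fG (has_dim_nonempty hG).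
  exists s; split=> //; move: hG; rewrite GE => /has_dim_uniq/(_ (has_dim_cube_face ss)).
  have := max_card (mem (supp s)); rewrite card_ord => sd.
  rewrite -subnDA addn1 => e.
  by rewrite -(subKn sd) -e subKn.
have pulledE (s : 'rV[R]_d) : sgv s = s ->
    pulled_points k (cube_face s) = pulled k s [set i | i \in supp s].
  move=> ss; rewrite pulled_points_cube_face//; congr image.
  by apply/seteqP; split=> i /=; rewrite inE.
have subS (s : 'rV[R]_d) (S : set 'rV[R]_d) : sgv s = s -> #|supp s| = m.+1 ->
    S `<=` pulled_points k (cube_face s) -> S #= `I_m ->
    exists j0, [/\ s 0 j0 != 0, #|(supp s :\ j0)%SET| = m &
                S = pulled k s [set i | i \in (supp s :\ j0)%SET]].
  move=> ss sm Ssub Sm.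
  have [|j0 [sj0 SE]] := @pulled_sub_card _ _ k s S m kn0 _ Sm sm.
    by move: Ssub; rewrite pulled_points_cube_face.
  have j0s : j0 \in supp s by rewrite inE.
  by exists j0; split=> //; apply/eqP; rewrite -eqSS -sm [X in _ == X](cardsD1 j0) j0s.
split=> [G fG hG|F].
  have [s [ss GE sm]] := face_sgv _ fG hG.
  rewrite GE; split.
  - rewrite facets_containing_cube_face//.
    have -> : [set i | s 0 i != 0] = [set i | i \in supp s].
      by apply/seteqP; split=> i /=; rewrite inE.
    rewrite -sm; apply: card_eq_trans (card_finset (supp s)).
    apply: inj_card_eq => i j /set_mem/= + _ /(cube_face_inj (sgv_facet i ss)).
    rewrite inE => si /rowP/(_ i); rewrite !mxE !eqxx /= mulr1.
    by case: eqP => // _ /eqP; rewrite mulr0 eq_sym (negPf si).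
  - by rewrite pulledE// -sm; exact: card_pulled.
  - move=> S Ssub Sm; have [j0 [_ sj0m ->]] := subS _ _ ss sm Ssub Sm.
    by apply: is_simplex_pulled => //; [exact: subD1set|rewrite prednK].
split=> [/(is_facet_scale_rho k0 kd k_nonint)[a [j0 [ha ->]]]|].
  have [am am1] := facet_normal_card_supp ha; rewrite -!/m in am am1.
  pose s := sgv a; have ss : sgv s = s := sgv_id a.
  have sa : supp s = supp a := supp_sgv a.
  pose S := pulled k s [set i | i \in (supp a :\ j0)%SET].
  exists (cube_face s), S, (convex_hull S); split.
  - split; first exact: is_face_cube_face.
    by have := has_dim_cube_face ss; rewrite sa am1 -subnDA addn1.
  - rewrite pulledE// => _ [i ij <-]; exists i => //=.
    by rewrite sa; move: ij; rewrite /= !inE => /andP[].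
  - by rewrite -am; apply: card_pulled => //; rewrite sa subD1set.
  - by apply: is_simplex_pulled => //; rewrite ?sa ?subD1set// am prednK.
  - by rewrite (facet_normal_face k0 ha) convex_hullUr.
move=> [G [S [alpha [[fG hG] Ssub Sm [p [_ _ ->]] ->]]]].
have [s [ss GE sm]] := face_sgv _ fG hG; rewrite GE in Ssub *.
have [j0 [sj0 sj0m ->]] := subS _ _ ss sm Ssub Sm.
(* The index whose pulled point is left out receives the fractional part of [k] as its weight in the
   normal vector. *)
have [||a ha aE] := @facet_normal_of_sgv _ _ k (k - m%:R) s j0 ss sj0.
- by rewrite subr_gt0 mk ltrBlDl natr1.
- by rewrite sj0m subrK.
have := is_facet_facet_normal k0 ha; rewrite (facet_normal_face k0 ha) aE.
by rewrite -(supp_sgv a) aE convex_hullUr.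
Qed.
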